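(* Let $P_1,\dots,P_t$ be posets, $S=\sum_{i=1}^t(|P_i|-1)$, and $H=\sum_{i=1}^t(h(P_i)-1)$, with $H>0$. Then \[ \operatorname{BR}^1(P_1,\dots,P_t) \leq \left(\tfrac{3}{2}H+1\right)\left(\log_2\left(\tfrac{S}{H}\right)+1\right). \]
   Context: $h(P)$ is the height of $P$, the maximum size of a chain in $P$. $B_n$ is the Boolean lattice of subsets of $[n]$. A copy of a poset $P$ in a poset $Q$ is the image of an injection $f:P\to Q$ with $f(x)\le f(y)$ whenever $x\le y$. $\operatorname{BR}^1(P_1,\dots,P_t)$ is the least $N$ such that every coloring of the elements of $B_N$ with colors $\{1,\dots,t\}$ contains, for some $i$, a copy of $P_i$ all of whose elements have color $i$. *)

(* Defs.v *)
From mathcomp Require Import all_boot all_order all_algebra.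
From mathcomp Require Import reals exp.

Set Implicit Arguments.
Unset Strict Implicit.
Unset Printing Implicit Defensive.

Import Order.DefaultSetSubsetOrder.

Local Open Scope order_scope.

Definition is_chain d (P : finPOrderType d) (C : {set P}) : bool :=
  [forall x in C, forall y in C, x >=< y].

Definition height d (P : finPOrderType d) : nat :=
  (\max_(C : {set P} | is_chain C) #|C|)%N.

Definition boolean_lattice (n : nat) :
    finPOrderType Order.SetSubsetOrder.subset_display :=
  {set 'I_n}.

(* Weak copies: f need not reflect the order. *)
Definition is_copy d d' (P : finPOrderType d) (Q : finPOrderType d')
    (A : {set Q}) : bool :=
  [exists f : {ffun P -> Q},
    [&& injectiveb f,
        [forall x, forall y, (x <= y) ==> (f x <= f y)] &
        A == f @: [set: P]]].

(* The colors 1, ..., t are represented by the elements of 'I_t. *)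
Definition boolean_ramsey_prop d (t : nat) (P : 'I_t -> finPOrderType d)
    (N : nat) : bool :=
  [forall c : {ffun boolean_lattice N -> 'I_t},
    exists i : 'I_t, exists A : {set boolean_lattice N},
      is_copy (P i) A && [forall a in A, c a == i]].

Lemma linear_extension d (P : finPOrderType d) :
  exists r : P -> nat, [/\ injective r, forall x, (r x < #|P|)%N
    & forall x y, x <= y -> (r x <= r y)%N].
Proof.
pose g (x : P) := #|[set y | y <= x]|.
pose s := sort (relpre g leq) (fintype.enum P).
have s_in x : x \in s by rewrite mem_sort mem_enum.
exists (index^~ s); split=> [x y eq_xy | x | x y le_xy].
- by rewrite -(nth_index x (s_in x)) eq_xy nth_index.
- by rewrite fintype.cardE -(size_sort (relpre g leq)) index_mem.
have sorted_s : sorted (relpre g leq) s.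
  by apply: sort_sorted => u v; apply: leq_total.
rewrite leqNgt; apply/negP => lt_yx.
have le_g : (g y <= g x)%N.
  have tr : transitive (relpre g leq) by move=> u v w; apply: leq_trans.
  have := @sorted_ltn_nth _ _ tr x s sorted_s (index y s) (index x s).
  by rewrite !inE !index_mem !s_in !nth_index //; apply.
have sub : [set z | z <= x] \subset [set z | z <= y].
  by apply/subsetP => z; rewrite !inE => /Order.POrderTheory.le_trans; apply.
have /eqP/setP/(_ y) : [set z | z <= x] == [set z | z <= y].
  by rewrite eqEcard sub.
rewrite !inE Order.POrderTheory.lexx => le_yx.
have eq_xy : x = y by apply: Order.POrderTheory.le_anti; rewrite le_xy le_yx.
by rewrite eq_xy ltnn in lt_yx.
Qed.

Lemma boolean_ramsey_exists d (t : nat) (P : 'I_t -> finPOrderType d) :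
  exists N, boolean_ramsey_prop P N.
Proof.
pose N := (\sum_(i < t) #|P i|)%N; exists N; apply/forallP => c.
pose C (k : nat) : boolean_lattice N := [set j : 'I_N | (j < k)%N].
have leC k l : (k <= l)%N -> C k <= C l.
  move=> le_kl; apply/subsetP => j; rewrite !inE.
  by move=> /leq_trans; apply.
have injC k l : (k <= N)%N -> (l <= N)%N -> C k = C l -> k = l.
  wlog lt_kl : k l / (k < l)%N => [wl kN lN eC | _ lN eC].
    have [lt_kl | lt_lk | //] := ltngtP k l; first exact: wl.
    by symmetry; apply: wl.
  have /setP/(_ (Ordinal (leq_trans lt_kl lN))) := eC.
  by rewrite !inE ltnn lt_kl.
pose s i := [seq k <- iota 0 N.+1 | c (C k) == i].
have sizes : (\sum_(i < t) size (s i) = N.+1)%N.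
  rewrite -[RHS](size_iota 0); rewrite /s; elim: (iota _ _) => [|k l IH] /=.
    by rewrite big1.
  rewrite -IH (bigD1 (c (C k))) //= eqxx /= addSn.
  rewrite [in RHS](bigD1 (c (C k))) //=; congr (_ + _).+1.
  by apply: eq_bigr => i /negPf; rewrite eq_sym => ->.
have /existsP [i le_i] : [exists i, #|P i| <= size (s i)]%N.
  rewrite -[X in is_true X]negbK negb_exists; apply/negP => /forallP h.
  have : (\sum_(i < t) size (s i) <= N)%N.
    by apply: leq_sum => i _; have := h i; rewrite -ltnNge => /ltnW.
  by rewrite sizes ltnn.
have [r [injr ltr ler]] := linear_extension (P i).
have rs x : (r x < size (s i))%N := leq_trans (ltr x) le_i.
pose f := [ffun x : P i => C (nth 0%N (s i) (r x))].
have memf x : nth 0%N (s i) (r x) \in s i by apply: mem_nth.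
have lef x : (nth 0%N (s i) (r x) <= N)%N.
  by have := memf x; rewrite mem_filter mem_iota => /andP[_].
apply/existsP; exists i; apply/existsP; exists (f @: [set: P i]).
apply/andP; split; last first.
  apply/forall_inP => _ /imsetP[x _ ->]; rewrite ffunE.
  by have := memf x; rewrite mem_filter => /andP[].
apply/existsP; exists f; rewrite eqxx andbT; apply/andP; split.
  apply/injectiveP => x y; rewrite !ffunE => /(injC _ _ (lef x) (lef y)) /eqP.
  by rewrite nth_uniq ?filter_uniq ?iota_uniq // => /eqP/injr.
apply/forallP => x; apply/forallP => y; apply/implyP => /ler le_r.
rewrite !ffunE; apply: leC.
apply: (sorted_leq_nth leq_trans leqnn 0%N) => //; rewrite ?inE //.
by apply: sorted_filter; [apply: leq_trans | apply: iota_sorted].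
Qed.

Definition BR1 d (t : nat) (P : 'I_t -> finPOrderType d) : nat :=
  ex_minn (boolean_ramsey_exists P).

Definition log2 (R : realType) (x : R) : R := (ln x / ln 2)%R.

(* Main.v *)
(** The elements of the Boolean lattice are read one at a time.  Suppose the
    coordinates [j < k] are already spent.  The elements read next are the sets
    consisting of all [j < k] together with the binary digits of [e = 0, 1, ...]
    placed from position [k] on.  An element of color [i] is assigned to the
    lowest unfilled level of [P_i].  When this fills the level, the coordinates
    touched so far are spent, so that all later elements lie strictly above all
    earlier ones; a phase which reads [c] elements costs [floor(log2 c) + 1]
    coordinates.  At most [H + 1] phases and [S + 1] elements are needed, so by
    concavity of the logarithm [(H + 1) (log2 ((S + 1) / (H + 1)) + 1)]
    coordinates suffice, which is at most the claimed bound as [H <= S]. *)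

Require Import Defs.
From mathcomp Require Import all_boot all_order all_algebra zify ring lra.
From mathcomp Require Import reals exp.
Import Order.TTheory GRing.Theory Num.Theory.

Local Open Scope nat_scope.

(** * Binary digits and bit lengths *)

Definition bitlen (n : nat) : nat := (trunc_log 2 n).+1.

Lemma ltn_bitlen n : n < 2 ^ bitlen n.
Proof. exact: trunc_log_ltn. Qed.

Lemma leq_bitlen m n : m <= n -> bitlen m <= bitlen n.
Proof. exact: leq_trunc_log. Qed.

Lemma divn_expS e j : e %/ 2 ^ j.+1 = e./2 %/ 2 ^ j.
Proof. by rewrite expnS divnMA divn2. Qed.

Lemma odd_digits_inj b e e' : e < 2 ^ b -> e' < 2 ^ b ->
  (forall j, j < b -> odd (e %/ 2 ^ j) = odd (e' %/ 2 ^ j)) -> e = e'.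
Proof.
elim: b e e' => [|b IH] e e' lt_e lt_e' eq_dig; first by lia.
have eq_half : e./2 = e'./2.
  apply: IH => [||j lt_j]; try (rewrite expnS in lt_e lt_e'; lia).
  by rewrite -!divn_expS eq_dig.
have := eq_dig 0 isT; rewrite expn0 !divn1 => eq_odd.
by rewrite -(odd_double_half e) -(odd_double_half e') eq_half eq_odd.
Qed.

Lemma all_digits_odd b e :
  (forall j, j < b -> odd (e %/ 2 ^ j)) -> 2 ^ b <= e.+1.
Proof.
elim: b e => [//|b IH] e odd_e; rewrite expnS.
have /IH le_half : forall j, j < b -> odd (e./2 %/ 2 ^ j).
  by move=> j lt_j; rewrite -divn_expS odd_e.
have := odd_e 0 isT; rewrite expn0 divn1.
by have := odd_double_half e; lia.
Qed.

(** * Sets read within one phase *)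

Definition initial_set (N k : nat) : {set 'I_N} := [set j : 'I_N | j < k].

Definition query_set (N k e : nat) : {set 'I_N} :=
  [set j : 'I_N | (j < k) || odd (e %/ 2 ^ (j - k))].

Lemma initial_setS N k l : k <= l -> initial_set N k \subset initial_set N l.
Proof.
move=> le_kl; apply/subsetP => j; rewrite !inE => lt_j.
by apply: leq_trans le_kl.
Qed.

Lemma initial_sub_query N k e : initial_set N k \subset query_set N k e.
Proof. by apply/subsetP => j; rewrite !inE => ->. Qed.

Lemma query_sub_initial N k e b :
  e < 2 ^ b -> query_set N k e \subset initial_set N (k + b).
Proof.
move=> lt_e; apply/subsetP => j; rewrite !inE.
case: ltnP => [|le_kj] /=; first lia.
apply: contraLR; rewrite -leqNgt => le_j.
rewrite divn_small //; apply: leq_trans lt_e _; apply: leq_pexp2l => //; lia.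
Qed.

Lemma query_set_inj N k e e' : k + bitlen (maxn e e') <= N ->
  query_set N k e = query_set N k e' -> e = e'.
Proof.
move=> le_N eq_q; apply: (@odd_digits_inj (bitlen (maxn e e'))).
- by apply: leq_ltn_trans (ltn_bitlen _); rewrite leq_maxl.
- by apply: leq_ltn_trans (ltn_bitlen _); rewrite leq_maxr.
move=> j lt_j; have lt_N : k + j < N by lia.
have /setP/(_ (Ordinal lt_N)) := eq_q.
by rewrite !inE /= addKn ltnNge leq_addr.
Qed.

(** The width is taken from [e.+1] to make the inclusion strict: if the digits of [e] in that width
    were all ones, [e.+1] would be at least [2 ^ bitlen e.+1]. Hence some touched coordinate is
    absent from the query. *)
Lemma query_proper_initial N k e : k + bitlen e.+1 <= N ->
  query_set N k e \proper initial_set N (k + bitlen e.+1).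
Proof.
move=> le_N; have lt_e : e.+1 < 2 ^ bitlen e.+1 := ltn_bitlen _.
rewrite properE query_sub_initial ?(ltnW lt_e) //=; apply/negP => /subsetP sub.
suff : 2 ^ bitlen e.+1 <= e.+1 by rewrite leqNgt lt_e.
apply: all_digits_odd => j lt_j; have lt_N : k + j < N by lia.
have := sub (Ordinal lt_N).
by rewrite !inE /= addKn ltn_add2l lt_j [X in X || _]ltnNge leq_addr; apply.
Qed.

(** Invariant of the sets read from query [e] on: the left case is the same phase, the right case
    any later phase. The bound by [N] ensures that no digit is cut off, so that queries of one phase
    stay distinct. *)
Definition after_query (N k e : nat) (U : {set 'I_N}) : Prop :=
  (exists2 e', e <= e' & k + bitlen e'.+1 <= N /\ U = query_set N k e') \/
  initial_set N (k + bitlen e.+1) \subset U.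

(** A later query of the phase differs from query [e] by its digits; a set of a later phase contains
    the touched coordinate which query [e] misses. *)
Lemma after_queryS N k e (U : {set 'I_N}) :
  k + bitlen e.+1 <= N -> after_query N k e.+1 U ->
  after_query N k e U /\ U != query_set N k e.
Proof.
move=> le_N [[e' lt_e [le_N' ->]]|sub_U].
  split; first by left; exists e' => //; apply: ltnW.
  apply/eqP => /query_set_inj; rewrite (maxn_idPl (ltnW lt_e)) => eq_e.
  suff : e' = e by lia.
  by apply: eq_e; apply: leq_trans le_N'; rewrite leq_add2l leq_bitlen.
have {}sub_U : initial_set N (k + bitlen e.+1) \subset U.
  apply: subset_trans sub_U; apply: initial_setS.
  by rewrite leq_add2l leq_bitlen.
split; first by right.
have /properP[_ [j j_in j_notin]] := query_proper_initial _ _ _ le_N.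
by apply/eqP => eq_U; move: j_notin; rewrite -eq_U (subsetP sub_U).
Qed.

Lemma after_query0 N k (U : {set 'I_N}) :
  after_query N k 0 U -> initial_set N k \subset U.
Proof.
case=> [[e' _ [_ ->]]|]; first exact: initial_sub_query.
by apply: subset_trans; apply: initial_setS; rewrite leq_addr.
Qed.

(** * The adaptive search *)

Definition strict_blocks (N : nat) (L : seq (seq {set 'I_N})) : bool :=
  all uniq L && pairwise (allrel (fun U V : {set 'I_N} => U \proper V)) L.

Lemma strict_blocks_cons N (B : seq {set 'I_N}) (L : seq (seq {set 'I_N})) :
  uniq B ->
  (forall U V : {set 'I_N}, U \in B -> V \in flatten L -> U \proper V) ->
  strict_blocks N L -> strict_blocks N (B :: L).
Proof.
move=> uB ltBL /andP[uL pL]; rewrite /strict_blocks /= uB uL pL !andbT /=.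
apply/allP => C C_in; apply/allrelP => U V U_in V_in.
by apply: ltBL => //; apply/flattenP; exists C.
Qed.

Lemma sumn_pos s : all (leq 1) s -> size s <= sumn s.
Proof. by elim: s => //= x s IH /andP[x_gt0 /IH]; lia. Qed.

(* In the state [(k, e, D)], [D i] lists the numbers of elements still missing
   in the unfilled levels of color [i].  The budget hypothesis ranges over all
   possible lists [s] of phase lengths; its first entry counts the [e] elements
   already read in the current phase.  Later blocks must lie above the
   coordinates touched now, while the first may share the current phase. *)
Lemma adaptive_search N t (c : {set 'I_N} -> 'I_t) m k e (D : 'I_t -> seq nat) :
  (forall i, D i != [::]) -> (forall i, all (leq 1) (D i)) ->
  \sum_i (sumn (D i)).-1 = m ->
  (forall s, size s = (\sum_i (size (D i)).-1).+1 -> all (leq 1) s ->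
     sumn s = m.+1 + e -> k + sumn (map bitlen s) <= N) ->
  exists i L, [/\ map size L = D i, strict_blocks N L,
    {in flatten L, forall U : {set 'I_N}, c U = i},
    {in flatten L, forall U : {set 'I_N}, after_query N k e U} &
    {in flatten (behead L),
      forall U : {set 'I_N}, initial_set N (k + bitlen e.+1) \subset U}].
Proof.
elim/ltn_ind: m k e D => m IH k e D D_n0 D_pos sumD budget.
have le_N : k + bitlen e.+1 <= N.
  pose n := \sum_i (size (D i)).-1.
  have le_nm : n <= m.
    rewrite -sumD; apply: leq_sum => i _.
    by have := sumn_pos _ (D_pos i); lia.
  (* There is room for query [e]: test the budget on a long current phase followed by [n] phases of
     length one. As [n <= m], the first entry is at least [e.+1]. *)
  have := budget ((e + m.+1 - n) :: nseq n 1).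
  rewrite /= size_nseq sumn_nseq; move/(_ erefl).
  have -> /= : all (leq 1) (nseq n 1) by rewrite all_nseq orbT.
  have [-> ->] : (0 < e + m.+1 - n) /\ (e + m.+1 - n + 1 * n = m.+1 + e) by lia.
  move=> /(_ isT erefl); have : bitlen e.+1 <= bitlen (e + m.+1 - n).
    by apply: leq_bitlen; lia.
  lia.
pose U0 := query_set N k e; pose i := c U0.
have after0 : after_query N k e U0 by left; exists e.
have lt_U0 (U : {set 'I_N}) :
    initial_set N (k + bitlen e.+1) \subset U -> U0 \proper U.
  exact: proper_sub_trans (query_proper_initial N k e le_N).
have := D_n0 i; have := D_pos i.
case eq_Di: (D i) => [//|w r] /= /andP[w_gt0 r_pos] _.
have [lt_1w|le_w1] := ltnP 1 w.
(* [U0] does not fill its level, so the phase goes on with query [e.+1]. *)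
- pose D' j := if j == i then w.-1 :: r else D j.
  have D'i : D' i = w.-1 :: r by rewrite /D' eqxx.
  have D'j j : j != i -> D' j = D j by rewrite /D' => /negPf ->.
  have eq_size : \sum_j (size (D' j)).-1 = \sum_j (size (D j)).-1.
    apply: eq_bigr => j _; have [->|/D'j -> //] := eqVneq j i.
    by rewrite D'i eq_Di.
  have sumD' : (\sum_j (sumn (D' j)).-1).+1 = m.
    rewrite -sumD (bigD1 i) //= [RHS](bigD1 i) //= D'i eq_Di /=.
    rewrite (eq_bigr (fun j => (sumn (D j)).-1)) => [|j /D'j -> //]; lia.
  have lt_m : \sum_j (sumn (D' j)).-1 < m by rewrite sumD'.
  have [||//||i' [L [sL bL cL aL tL]]] := IH _ lt_m k e.+1 D'.
  + by move=> j; rewrite /D'; case: (j == i).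
  + move=> j; rewrite /D'; case: (j == i) => //=; rewrite r_pos; lia.
  + by move=> s; rewrite eq_size sumD' => ss ps es; apply: budget => //; lia.
  have tL' (U : {set 'I_N}) : U \in flatten (behead L) ->
      initial_set N (k + bitlen e.+1) \subset U.
    move=> /tL; apply: subset_trans; apply: initial_setS.
    by rewrite leq_add2l leq_bitlen.
  (* If another color succeeds, [U0] is dropped; otherwise it completes the first block, and [tL']
     puts it strictly below all later blocks. *)
  have [eq_i|ne_i] := eqVneq i' i; last first.
    exists i', L; split=> //; first by rewrite sL D'j.
    by move=> U /aL /(after_queryS _ _ _ _ le_N)[].
  move: sL bL cL aL tL'; rewrite eq_i D'i.
  case: L {tL} => [//|B L] /= [sB sL] /andP[/andP[uB uL]] /andP[pB pL] cL aL tL.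
  exists i, ((U0 :: B) :: L); split=> //=.
  + by rewrite eq_Di sB sL prednK.
  + apply: strict_blocks_cons; last exact/andP.
      rewrite /= uB andbT; apply/negP => U0_in.
      have /aL : U0 \in B ++ flatten L by rewrite mem_cat U0_in.
      by case/(after_queryS _ _ _ _ le_N) => _; rewrite eqxx.
    move=> U V; rewrite inE => /predU1P[->|U_in] V_in; first exact/lt_U0/tL.
    have [C C_in V_in'] := flattenP V_in.
    by have /allP/(_ _ C_in)/allrelP := pB; apply.
  + by move=> U; rewrite inE => /predU1P[-> //|/cL].
  + move=> U; rewrite inE => /predU1P[-> //|].
    by move=> /aL /(after_queryS _ _ _ _ le_N)[].
have {le_w1 w_gt0} w1 : w = 1 by lia.
rewrite {}w1 in eq_Di.
(* If the filled level was the last one of color [i], the search ends with [U0]. *)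
have [r0|r_n0] := eqVneq r [::].
  exists i, [:: [:: U0]]; split=> //=; first by rewrite eq_Di r0.
    by move=> U; rewrite inE => /eqP ->.
  by move=> U; rewrite inE => /eqP ->.
pose D' j := if j == i then r else D j.
have D'i : D' i = r by rewrite /D' eqxx.
have D'j j : j != i -> D' j = D j by rewrite /D' => /negPf ->.
have r_gt0 : 0 < size r by rewrite lt0n size_eq0.
have r_sum := sumn_pos _ r_pos.
have eq_size : (\sum_j (size (D' j)).-1).+1 = \sum_j (size (D j)).-1.
  rewrite (bigD1 i) //= [RHS](bigD1 i) //= D'i eq_Di /=.
  rewrite (eq_bigr (fun j => (size (D j)).-1)) => [|j /D'j -> //]; lia.
have sumD' : (\sum_j (sumn (D' j)).-1).+1 = m.
  rewrite -sumD (bigD1 i) //= [RHS](bigD1 i) //= D'i eq_Di /=.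
  rewrite (eq_bigr (fun j => (sumn (D j)).-1)) => [|j /D'j -> //]; lia.
have lt_m : \sum_j (sumn (D' j)).-1 < m by rewrite sumD'.
(* A filled level closes the phase. The next one starts past the touched coordinates, so all its
   sets lie strictly above [U0]. *)
have [||//||i' [L [sL bL cL aL _]]] := IH _ lt_m (k + bitlen e.+1) 0 D'.
- by move=> j; rewrite /D'; case: (j == i).
- by move=> j; rewrite /D'; case: (j == i).
- move=> s; rewrite eq_size sumD' => ss ps es.
  (* The closed phase has read [e.+1] elements, counting [U0]. *)
  by rewrite -addnA; apply: (budget (e.+1 :: s)) => //=; [rewrite ss | lia].
have {}aL (U : {set 'I_N}) :
    U \in flatten L -> initial_set N (k + bitlen e.+1) \subset U.
  by move=> /aL /after_query0.
have [eq_i|ne_i] := eqVneq i' i; last first.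
  exists i', L; split=> //; first by rewrite sL D'j.
    by move=> U /aL sub; right.
  move=> U U_in; apply: aL; case: L {sL bL cL} U_in => //= B L U_in.
  by rewrite mem_cat U_in orbT.
exists i, ([:: U0] :: L); split=> //=.
- by rewrite eq_Di sL eq_i D'i.
- by apply: strict_blocks_cons => // U V; rewrite inE => /eqP -> /aL /lt_U0.
- by move=> U; rewrite inE => /predU1P[-> //|/cL ->].
- by move=> U; rewrite inE => /predU1P[-> //|/aL]; right.
Qed.

(** * Levels of a finite poset, and copies built from blocks *)

Section Levels.
Variables (d : Order.disp_t) (P : finPOrderType d).
Implicit Types (x y : P) (C : {set P}).

Definition below_chain x C : bool := is_chain C && [forall y in C, (y < x)%O].

Definition level x : nat := \max_(C | below_chain x C) #|C|.

Lemma is_chain0 : is_chain (set0 : {set P}).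
Proof. by apply/forall_inP => x; rewrite inE. Qed.

Lemma below_chain0 x : below_chain x set0.
Proof.
by rewrite /below_chain is_chain0; apply/forall_inP => y; rewrite inE.
Qed.

Lemma level_attained x : exists2 C : {set P}, below_chain x C & #|C| = level x.
Proof.
rewrite /level (bigop.bigmax_eq_arg set0) ?below_chain0 //.
by case: arg_maxnP => [|C bC _]; [exact: below_chain0 | exists C].
Qed.

Lemma height_attained : exists2 C : {set P}, is_chain C & #|C| = height P.
Proof.
rewrite /height (bigop.bigmax_eq_arg set0) ?is_chain0 //.
by case: arg_maxnP => [|C cC _]; [exact: is_chain0 | exists C].
Qed.

Lemma below_chainU1 x C :
  below_chain x C -> is_chain (x |: C) /\ #|x |: C| = #|C|.+1.
Proof.
move=> /andP[/forall_inP cC /forall_inP ltC]; split.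
  apply/forall_inP => u; rewrite !inE => u_in; apply/forall_inP => v.
  rewrite !inE; case/predU1P: u_in => [->|u_in] /predU1P[->|v_in].
  - exact: comparablexx.
  - by rewrite comparable_sym lt_comparable ?ltC.
  - by rewrite lt_comparable ?ltC.
  - exact: (forall_inP (cC u u_in)).
by rewrite cardsU1; case: (boolP (x \in C)) => [/ltC|//]; rewrite ltxx.
Qed.

Lemma level_lt_height x : level x < height P.
Proof.
have [C bC <-] := level_attained x; have [cC <-] := below_chainU1 _ _ bC.
exact: leq_bigmax_cond.
Qed.

Lemma level_lt x y : (x < y)%O -> level x < level y.
Proof.
move=> lt_xy; have [C bC <-] := level_attained x.
have [cC <-] := below_chainU1 _ _ bC; apply: leq_bigmax_cond.
rewrite /below_chain cC; apply/forall_inP => z; rewrite !inE.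
case/predU1P => [-> //|z_in]; apply: lt_trans lt_xy.
by have /andP[_ /forall_inP] := bC; apply.
Qed.

(** Levels are distinct along a maximum chain, whose size is the number of possible values, so this
    chain already meets every level. *)
Lemma level_onto a : a < height P -> exists x, level x = a.
Proof.
move=> lt_a; have [C /forall_inP cC hC] := height_attained.
pose lev x := Ordinal (level_lt_height x).
have inj_lev : {in C &, injective lev}.
  move=> x y x_in y_in [eq_lev]; have := forall_inP (cC x x_in) y y_in.
  by case: comparableP => // /level_lt; rewrite eq_lev ltnn.
have : Ordinal lt_a \in lev @: C.
  suff -> : lev @: C = setT by rewrite inE.
  by apply/eqP; rewrite eqEcard subsetT cardsT card_ord card_in_imset // hC /=.
by case/imsetP => x _ [eq_a]; exists x.
Qed.

Definition level_sizes : seq nat :=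
  mkseq (fun a => #|[set x | level x == a]|) (height P).

Lemma level_sizes_pos : all (leq 1) level_sizes.
Proof.
apply/allP => n /mapP[a]; rewrite mem_iota => /andP[_ /level_onto[x lev_x]] ->.
by apply/card_gt0P; exists x; rewrite inE lev_x.
Qed.

Lemma sumn_level_sizes : sumn level_sizes = #|P|.
Proof.
rewrite sumnE big_map -[X in iota 0 X]subn0 -/(index_iota 0 _) big_mkord.
pose lev x := Ordinal (level_lt_height x).
rewrite -sum1_card (partition_big lev xpredT) //=.
by apply: eq_bigr => a _; rewrite -sum1_card; apply: eq_bigl => x; rewrite inE.
Qed.

(** Each level is sent injectively into its block. Strict comparabilities of [P] raise the level,
    hence move to a higher block; incomparable elements are unconstrained because copies are
    weak. *)
Lemma copy_of_blocks N (L : seq (seq {set 'I_N})) :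
  map size L = level_sizes -> strict_blocks N L ->
  exists2 A : {set boolean_lattice N}, is_copy P A & {subset A <= flatten L}.
Proof.
move=> sizeL /andP[/allP uL /pairwiseP-/(_ [::]) pL].
have szL : size L = height P by rewrite -(size_map size) sizeL size_mkseq.
pose lv x := [set y | level y == level x].
pose pos x := index x (fintype.enum (lv x)).
have x_lv x : x \in fintype.enum (lv x) by rewrite mem_enum inE.
have lev_szL x : level x < size L by rewrite szL level_lt_height.
have posP x : pos x < size (nth [::] L (level x)).
  rewrite -(nth_map _ 0) // sizeL nth_mkseq ?level_lt_height //.
  by rewrite cardE index_mem.
pose f : {ffun P -> boolean_lattice N} :=
  [ffun x => nth set0 (nth [::] L (level x)) (pos x)].
have f_in x : f x \in nth [::] L (level x) by rewrite ffunE; apply/mem_nth/posP.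
have f_lt x y : level x < level y -> f x \proper f y.
  move=> lt_lev; have := pL (level x) (level y) (lev_szL x) (lev_szL y) lt_lev.
  by move=> /allrelP; apply; apply: f_in.
exists (f @: setT); last first.
  move=> _ /imsetP[x _ ->]; apply/flattenP.
  by exists (nth [::] L (level x)); [apply/mem_nth/lev_szL | apply: f_in].
apply/existsP; exists f; rewrite eqxx andbT; apply/andP; split.
  apply/injectiveP => x y eq_f; case: (ltngtP (level x) (level y)).
  - by move/f_lt; rewrite eq_f properxx.
  - by move/f_lt; rewrite eq_f properxx.
  move=> eq_lev; have eq_lv : lv x = lv y by rewrite /lv eq_lev.
  have eq_pos : pos x = pos y.
    move: eq_f; rewrite !ffunE eq_lev => /eqP.
    rewrite nth_uniq; first by move/eqP.
    - by rewrite -eq_lev; apply: posP.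
    - exact: posP.
    - exact/uL/mem_nth/lev_szL.
  by rewrite -(nth_index x (x_lv x)) -/(pos x) eq_pos /pos eq_lv nth_index.
apply/forallP => x; apply/forallP => y; apply/implyP.
by rewrite le_eqVlt => /predU1P[-> //|/level_lt /f_lt /proper_sub].
Qed.

End Levels.

(** * Logarithmic bounds on the number of coordinates *)

Lemma log2_ge0 (R : realType) (x : R) : (1 <= x -> 0 <= log2 x)%R.
Proof. by move=> x_ge1; rewrite divr_ge0 ?ln_ge0 // ler1n. Qed.

Lemma le_log2 (R : realType) (x y : R) :
  (0 < x -> x <= y -> log2 x <= log2 y)%R.
Proof.
move=> x_gt0 le_xy; rewrite ler_pM2r ?invr_gt0 ?ln_gt0 ?ltr1n //.
by rewrite ler_ln ?posrE // (lt_le_trans x_gt0).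
Qed.

Lemma bitlen_le_log2 (R : realType) n :
  0 < n -> ((bitlen n)%:R <= log2 (n%:R : R) + 1)%R.
Proof.
move=> n_gt0; rewrite -natr1 lerD2r ler_pdivlMr ?ln_gt0 ?ltr1n //.
rewrite mulr_natl -lnXn ?ltr0n // ler_ln ?posrE ?exprn_gt0 ?ltr0n //.
by rewrite -natrX ler_nat trunc_logP.
Qed.

(** Concavity as a tangent line at [a], from [ln (1 + u) <= u] with [u = x / a - 1]. *)
Lemma log2_tangent (R : realType) (a x : R) :
  (0 < a -> 0 < x -> log2 x <= log2 a + (x / a - 1) / ln 2)%R.
Proof.
move=> a_gt0 x_gt0; rewrite -mulrDl ler_pM2r ?invr_gt0 ?ln_gt0 ?ltr1n //.
rewrite -lerBlDl -ln_div ?posrE //.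
rewrite -[X in ln X](_ : 1 + (x / a - 1) = _)%R; last by ring.
by rewrite le_ln1Dx //; have := divr_gt0 x_gt0 a_gt0; lra.
Qed.

Lemma sum_bitlen_tangent (R : realType) (a : R) (s : seq nat) :
  (0 < a)%R -> all (leq 1) s ->
  ((sumn (map bitlen s))%:R <= (size s)%:R * (log2 a + 1) +
    ((sumn s)%:R / a - (size s)%:R) / ln 2)%R.
Proof.
move=> a_gt0; elim: s => [|n s IH] /=.
  by rewrite !mul0r subrr mul0r addr0.
case/andP=> n_gt0 /IH {}IH; rewrite natrD.
have n_gt0' : (0 < n%:R :> R)%R by rewrite ltr0n.
have tangent := lerD (log2_tangent _ _ _ a_gt0 n_gt0') (lexx 1%R).
have := le_trans (bitlen_le_log2 R n n_gt0) tangent.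
move/lerD/(_ IH)/le_trans; apply; rewrite le_eqVlt; apply/orP; left; apply/eqP.
by rewrite -natr1 natrD; ring.
Qed.

(** Jensen's inequality: the tangent is taken at the mean of [s], where the linear corrections add
    up to zero. *)
Lemma sum_bitlen_le (R : realType) (s : seq nat) :
  all (leq 1) s -> 0 < size s ->
  ((sumn (map bitlen s))%:R <=
    (size s)%:R * (log2 ((sumn s)%:R / (size s)%:R : R) + 1))%R.
Proof.
move=> s_pos s_gt0; set a : R := (_ / _)%R.
have sum_gt0 : 0 < sumn s by apply: leq_trans (sumn_pos _ s_pos).
have a_gt0 : (0 < a)%R by rewrite divr_gt0 ?ltr0n.
have := sum_bitlen_tangent R a s a_gt0 s_pos.
have -> : ((sumn s)%:R / a = (size s)%:R)%R.
  by rewrite invf_div mulrCA divff ?mulr1 // gt_eqF ?ltr0n.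
by rewrite addrN mul0r addr0.
Qed.

(** * From the search to the bound on [BR1] *)

Lemma is_copy_empty d d' (P : finPOrderType d) (Q : finPOrderType d') (q : Q) :
  #|P| = 0 -> is_copy P (set0 : {set Q}).
Proof.
move=> /card0_eq P0; apply/existsP; exists [ffun=> q]; apply/and3P; split.
- by apply/injectiveP => x; have := P0 x; rewrite inE.
- by apply/forallP => x; have := P0 x; rewrite inE.
apply/eqP/setP => y; rewrite inE; symmetry; apply/imsetP => -[x].
by have := P0 x; rewrite inE.
Qed.

Lemma boolean_ramsey_empty d t (P : 'I_t -> finPOrderType d) i N :
  #|P i| = 0 -> boolean_ramsey_prop P N.
Proof.
move=> P0; apply/forallP => c; apply/existsP; exists i.
apply/existsP; exists set0.
rewrite (is_copy_empty _ _ _ (boolean_lattice N) set0 P0) /=.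
by apply/forall_inP => U; rewrite inE.
Qed.

Lemma height_gt0 d (P : finPOrderType d) : 0 < #|P| -> 0 < height P.
Proof.
by case/card_gt0P=> x _; apply: leq_ltn_trans (level_lt_height _ _ x).
Qed.

Lemma boolean_ramsey_budget d t (P : 'I_t -> finPOrderType d) N :
  (forall i, 0 < #|P i|) ->
  (forall s, size s = (\sum_i (height (P i)).-1).+1 -> all (leq 1) s ->
     sumn s = (\sum_i #|P i|.-1).+1 -> sumn (map bitlen s) <= N) ->
  boolean_ramsey_prop P N.
Proof.
move=> P_gt0 budget; apply/forallP => c.
have [||||i [L [sizeL bL cL _ _]]] := adaptive_search N t c
  (\sum_i #|P i|.-1) 0 0 (fun i => level_sizes _ (P i)).
- by move=> i; rewrite -size_eq0 size_mkseq -lt0n height_gt0.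
- by move=> i; apply: level_sizes_pos.
- by apply: eq_bigr => i _; rewrite sumn_level_sizes.
- move=> s; under eq_bigr do rewrite size_mkseq.
  by rewrite addn0 add0n; apply: budget.
have [A copyA subA] := copy_of_blocks _ _ _ _ sizeL bL.
apply/existsP; exists i; apply/existsP; exists A; rewrite copyA /=.
by apply/forall_inP => U /subA /cL ->.
Qed.

Lemma height_le_card d (P : finPOrderType d) : height P <= #|P|.
Proof. by apply/bigmax_leqP => C _; apply: max_card. Qed.

Local Open Scope ring_scope.

Theorem theorem2p13 (R : realType) (t : nat) (d : Order.disp_t)
    (P : 'I_t -> finPOrderType d) :
  let S : R := \sum_(i < t) (#|P i|%:R - 1) in
  let H : R := \sum_(i < t) ((height (P i))%:R - 1) in
  0 < H ->
  (BR1 P)%:R <= (3 / 2 * H + 1) * (log2 (S / H) + 1).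
Proof.
move=> S H H_gt0.
have le_HS : H <= S.
  by apply: ler_sum => i _; rewrite lerD2r ler_nat height_le_card.
have SH_ge1 : 1 <= S / H by rewrite ler_pdivlMr ?mul1r.
have log_ge0 := log2_ge0 R _ SH_ge1.
set b := (X in _ <= X); have b_ge0 : 0 <= b.
  by rewrite mulr_ge0 // addr_ge0 // mulr_ge0 ?divr_ge0 // ltW.
suff ramsey : boolean_ramsey_prop P (Num.truncn b).
  rewrite /BR1; case: ex_minnP => N _ /(_ _ ramsey) le_N.
  by apply: le_trans (_ : (Num.truncn b)%:R <= b); rewrite ?ler_nat ?truncn_le.
(* An empty poset contributes [-1] to the real sums but [0] through [.-1], so it is treated
   apart. *)
have [/existsP[i /eqP P0]|] := boolP [exists i, #|P i| == 0%N].
  exact: boolean_ramsey_empty P0.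
rewrite negb_exists => /forallP P_n0.
have P_gt0 i : (0 < #|P i|)%N by rewrite lt0n.
have eq_S : S = (\sum_i #|P i|.-1)%N%:R.
  by rewrite natr_sum; apply: eq_bigr => i _; rewrite -subn1 natrB.
have eq_H : H = (\sum_i (height (P i)).-1)%N%:R.
  rewrite natr_sum; apply: eq_bigr => i _.
  by rewrite -subn1 natrB // height_gt0.
apply: boolean_ramsey_budget => // s size_s s_pos sum_s.
rewrite truncn_ge_nat //; have := sum_bitlen_le R s s_pos; rewrite size_s sum_s.
move=> /(_ isT) /le_trans; apply; rewrite -!natr1 -eq_S -eq_H.
(* Factorwise: [H + 1 <= 3 / 2 * H + 1], and [(S + 1) / (H + 1) <= S / H] because [H <= S]. *)
apply: ler_pM; try lra.
- have : 1 <= (S + 1) / (H + 1) by rewrite ler_pdivlMr; lra.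
  by move/(log2_ge0 R); lra.
rewrite lerD2r; apply: le_log2; first by rewrite divr_gt0; lra.
rewrite ler_pdivlMr // mulrAC ler_pdivrMr; last by lra.
by rewrite mulrDl mulrDr mul1r mulr1 lerD2l.
Qed.
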